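(* For all integers $n\ge 0$ the following hold as identities of rational functions in $x$: 1. $\rho_n(x)=\dfrac{H_n(x)}{H_{n-1}(x^2)}$. 2. $\lambda_n^+(x)=\dfrac{I_{n+1}(x)}{I_n(x^2)}$. 3. $\lambda_n(x)=\dfrac{xF_n(x^3)}{G_{n-1}(x^6)}$ if $n$ is even, and $\lambda_n(x)=\dfrac{G_n(x^3)}{x^2F_{n-1}(x^6)}$ if $n$ is odd.
   Context: Write $[a_0;a_1,\dots,a_n]=a_0+\cfrac{1}{a_1+\cfrac{1}{\ddots+\cfrac{1}{a_n}}}$. For $n\ge 0$ define $\lambda_n(x)=[x;x^2,x^4,\dots,x^{2^n}]$; $\lambda_n^+(x)$ is the same continued fraction with last partial quotient $x^{2^n}$ replaced by $x^{2^n}+1$ (so $\lambda_0^+(x)=x+1$, $\lambda_1^+(x)=[x;x^2+1]$, etc.); and $\rho_n(x)$ is defined by $\rho_0(x)=1$ and $\rho_n(x)=1+\dfrac{x}{\rho_{n-1}(x^2)}$ for $n\ge1$, i.e. $\rho_n(x)=1+\cfrac{x}{1+\cfrac{x^2}{1+\cfrac{x^4}{\ddots+\cfrac{x^{2^{n-1}}}{1}}}}$. Let $F(q)=\sum a_mq^m$, $G(q)=\sum b_mq^m$ be the unique power series with $F(0)=G(0)=1$, $F(q)=G(q^2)+qF(q^4)$, $G(q)=qF(q^2)+G(q^4)$. Let $H(q)=\sum c_mq^m$ be the unique power series with $H(0)=1$, $H(q)=H(q^2)+qH(q^4)$. Let $I(q)=\sum d_mq^m$ be the unique power series with $I(0)=1$,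 $I(q)=qI(q^2)+I(q^4)$. For $n\ge0$ put $F_n(x)=\sum_{m=0}^{2^n-1}a_mx^m$, $G_n(x)=\sum_{m=0}^{2^n-1}b_mx^m$, $H_n(x)=\sum_{m=0}^{2^n-1}c_mx^m$, $I_n(x)=\sum_{m=0}^{2^n-1}d_mx^m$, and for $n<0$ put $F_n=G_n=H_n=I_n=1$. *)

(* Defs.v *)
From HB Require Import structures.
From mathcomp Require Import all_boot all_order all_algebra.

Set Implicit Arguments.
Unset Strict Implicit.
Unset Printing Implicit Defensive.

Import GRing.Theory.
Local Open Scope ring_scope.

Notation ratfun := {fraction {poly rat}}.

(* [cfrac [:: a_0; ..; a_n]] is [a_0; a_1, .., a_n]; the value on the empty
   sequence is a dummy. *)
Fixpoint cfrac (K : fieldType) (s : seq K) : K :=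
  match s with
  | [::] => 0
  | [:: a] => a
  | a :: s' => a + 1 / cfrac s'
  end.

Definition lambda (K : fieldType) (n : nat) (x : K) : K :=
  cfrac (mkseq (fun i => x ^+ (2 ^ i)) n.+1).

Definition lambda_plus (K : fieldType) (n : nat) (x : K) : K :=
  cfrac (rcons (mkseq (fun i => x ^+ (2 ^ i)) n) (x ^+ (2 ^ n) + 1)).

Fixpoint rho (K : fieldType) (n : nat) (x : K) : K :=
  if n is n'.+1 then 1 + x / rho n' (x ^+ 2) else 1.

(* A formal power series is given by its sequence of coefficients. *)
Definition powser := nat -> rat.

Definition ps_add (A B : powser) : powser := fun m => A m + B m.

(* q * A(q) *)
Definition ps_mulq (A : powser) : powser :=
  fun m => if m is m'.+1 then A m' else 0.

(* A(q^k), for k > 0 *)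
Definition ps_subst (k : nat) (A : powser) : powser :=
  fun m => if (k %| m)%N then A (m %/ k)%N else 0.

Definition FG_spec (F G : powser) : Prop :=
  [/\ F 0%N = 1, G 0%N = 1,
      F =1 ps_add (ps_subst 2 G) (ps_mulq (ps_subst 4 F))
    & G =1 ps_add (ps_mulq (ps_subst 2 F)) (ps_subst 4 G)].

Definition H_spec (H : powser) : Prop :=
  H 0%N = 1 /\ H =1 ps_add (ps_subst 2 H) (ps_mulq (ps_subst 4 H)).

Definition I_spec (I : powser) : Prop :=
  I 0%N = 1 /\ I =1 ps_add (ps_mulq (ps_subst 2 I)) (ps_subst 4 I).

Definition trunc2 (A : powser) (n : int) : {poly rat} :=
  match n with
  | Posz k => \poly_(m < 2 ^ k) A m
  | Negz _ => 1
  end.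

(* p(x^k), as a rational function of the indeterminate x *)
Definition at_Xn (p : {poly rat}) (k : nat) : ratfun :=
  tofrac (p \Po 'X^k).

(* The indeterminate x.  Substituting x^k in a rational function R(x) is
   evaluating R at ratX ^+ k; the denominators met in lambda, lambda_plus and
   rho at such arguments are nonzero, so that the convention 0^-1 = 0 plays no
   role. *)
Definition ratX : ratfun := tofrac 'X.

(* The specifications determine the series uniquely, and are satisfiable, so
   that "for all F, G with FG_spec F G" means "for the unique F, G". *)

Lemma causal_fix (V : Type) (v : V) (T : (nat -> V) -> nat -> V) :
  (forall a b m, (forall k, (k < m)%N -> a k = b k) -> T a m = T b m) ->
  exists a, a =1 T a.
Proof.
move=> Tc; pose u n := iter n T (fun=> v).
have st m : forall n p, (m < n)%N -> (m < p)%N -> u n m = u p m.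
  elim/ltn_ind: m => m IH [|n] [|p] // mn mp.
  apply: Tc => k km; apply: IH => //.
    exact: leq_trans km mn.
  exact: leq_trans km mp.
exists (fun m => u m.+1 m) => m.
apply: Tc => k km; exact: (st k m k.+1 km (ltnSn k)).
Qed.

Lemma causal_uniq (V : Type) (T : (nat -> V) -> nat -> V) (a b : nat -> V) :
  (forall a b m, (forall k, (k < m)%N -> a k = b k) -> T a m = T b m) ->
  a =1 T a -> b =1 T b -> a =1 b.
Proof.
by move=> Tc ea eb; elim/ltn_ind => m IH; rewrite ea eb; apply: Tc.
Qed.

Lemma ps_subst_causal (k : nat) (A B : powser) (m : nat) :
  (1 < k)%N -> (0 < m)%N ->
  (forall i, (i < m)%N -> A i = B i) -> ps_subst k A m = ps_subst k B m.
Proof.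
move=> k1 m0 AB; rewrite /ps_subst; case: ifP => // _.
by apply: AB; rewrite ltn_Pdiv.
Qed.

Lemma ps_mulq_causal (k : nat) (A B : powser) (m : nat) :
  (0 < k)%N -> (forall i, (i < m)%N -> A i = B i) ->
  ps_mulq (ps_subst k A) m = ps_mulq (ps_subst k B) m.
Proof.
case: m => [|m] // k0 AB; rewrite /= /ps_subst; case: ifP => // _.
by apply: AB; rewrite ltnS leq_div.
Qed.

Definition FG_step (u : nat -> rat * rat) (m : nat) : rat * rat :=
  let F i := (u i).1 in let G i := (u i).2 in
  if m is 0 then (1, 1)
  else (ps_add (ps_subst 2 G) (ps_mulq (ps_subst 4 F)) m,
        ps_add (ps_mulq (ps_subst 2 F)) (ps_subst 4 G) m).

Definition H_step (H : powser) (m : nat) : rat :=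
  if m is 0 then 1 else ps_add (ps_subst 2 H) (ps_mulq (ps_subst 4 H)) m.

Definition I_step (I : powser) (m : nat) : rat :=
  if m is 0 then 1 else ps_add (ps_mulq (ps_subst 2 I)) (ps_subst 4 I) m.

Lemma FG_step_causal u v m :
  (forall k, (k < m)%N -> u k = v k) -> FG_step u m = FG_step v m.
Proof.
case: m => [|m] // uv; rewrite /FG_step /ps_add.
have uv1 i : (i < m.+1)%N -> (u i).1 = (v i).1 by move/uv->.
have uv2 i : (i < m.+1)%N -> (u i).2 = (v i).2 by move/uv->.
rewrite (ps_subst_causal (k := 2) _ _ uv2) // (ps_subst_causal (k := 4) _ _ uv2) //.
by rewrite (ps_mulq_causal (k := 2) _ uv1) // (ps_mulq_causal (k := 4) _ uv1).
Qed.

Lemma H_step_causal A B m :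
  (forall k, (k < m)%N -> A k = B k) -> H_step A m = H_step B m.
Proof.
case: m => [|m] // AB; rewrite /H_step /ps_add.
by rewrite (ps_subst_causal (k := 2) _ _ AB) // (ps_mulq_causal (k := 4) _ AB).
Qed.

Lemma I_step_causal A B m :
  (forall k, (k < m)%N -> A k = B k) -> I_step A m = I_step B m.
Proof.
case: m => [|m] // AB; rewrite /I_step /ps_add.
by rewrite (ps_subst_causal (k := 4) _ _ AB) // (ps_mulq_causal (k := 2) _ AB).
Qed.

Lemma FG_exists : exists F G, FG_spec F G.
Proof.
have [u eu] := causal_fix (0, 0) FG_step_causal.
exists (fun i => (u i).1), (fun i => (u i).2).
split; rewrite ?eu //; case=> [|m]; rewrite {1}eu //.
- by rewrite /ps_add /= addr0 /ps_subst div0n eu.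
- by rewrite /ps_add /= add0r /ps_subst div0n eu.
Qed.

Lemma FG_unique F G F' G' :
  FG_spec F G -> FG_spec F' G' -> F =1 F' /\ G =1 G'.
Proof.
move=> [F0 G0 eF eG] [F0' G0' eF' eG'].
have e : (fun i => (F i, G i)) =1 (fun i => (F' i, G' i)).
  apply: (causal_uniq FG_step_causal) => -[|m].
  - by rewrite F0 G0.
  - by rewrite eF eG.
  - by rewrite F0' G0'.
  - by rewrite eF' eG'.
by split=> i; case: (e i).
Qed.

Lemma H_exists : exists H, H_spec H.
Proof.
have [H eH] := causal_fix 0 H_step_causal; exists H.
split=> [|[|m]]; rewrite {1}eH //.
by rewrite /ps_add /= addr0 /ps_subst div0n eH.
Qed.

Lemma H_unique H H' : H_spec H -> H_spec H' -> H =1 H'.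
Proof.
move=> [H0 eH] [H0' eH'].
by apply: (causal_uniq H_step_causal) => -[|m]; rewrite ?H0 ?H0' // ?eH ?eH'.
Qed.

Lemma I_exists : exists I, I_spec I.
Proof.
have [I eI] := causal_fix 0 I_step_causal; exists I.
split=> [|[|m]]; rewrite {1}eI //.
by rewrite /ps_add /= add0r /ps_subst div0n eI.
Qed.

Lemma I_unique I I' : I_spec I -> I_spec I' -> I =1 I'.
Proof.
move=> [I0 eI] [I0' eI'].
by apply: (causal_uniq I_step_causal) => -[|m]; rewrite ?I0 ?I0' // ?eI ?eI'.
Qed.

(* Main.v *)
Require Import Defs.
From HB Require Import structures.
From mathcomp Require Import all_boot all_order all_algebra.
From mathcomp Require Import zify ring.

(** Reading a functional equation such as H(q) = H(q^2) + q H(q^4) modulo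
    q^(2^(n+1)) gives a recursion between truncations,
    H_(n+1)(q) = H_n(q^2) + q H_(n-1)(q^4); it loses nothing because the
    exponents 2m, 2m+1, 4m and 4m+1 are below 2^(n+1) exactly when m is below
    the matching smaller power of 2.  Dividing by H_n(q^2) gives
      H_(n+1)(q) / H_n(q^2) = 1 + q / (H_n(q^2) / H_(n-1)(q^4)),
    which is the recursion that defines rho, with x replaced by x^2 in the
    recursive call.  The series I, and the pair F, G after q is set to x^3, yield
    in the same way the recursion L_(n+1)(x) = x + 1 / L_n(x^2) shared by
    lambda and lambda_plus; F and G exchange their roles at each step, whence
    the distinction by the parity of n.

    The two kinds of functional equation are truncated in [trunc2_evenS] and
    [trunc2_oddS].  Since the recursions pass from x to x^2, the three
    identities are proved by induction on n at every power x^k of the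
    indeterminate at once ([rho_trunc2], [lambda_plus_trunc2],
    [lambda_trunc2]).  The divisions are legitimate because every truncation
    has constant coefficient 1. *)

Set Implicit Arguments.
Unset Strict Implicit.
Unset Printing Implicit Defensive.

Import GRing.Theory.
Local Open Scope ring_scope.

(** * Truncations of power series *)

(** The bounds say that no multiple of k lies in [N, k * M), so that cutting
    A(q^k) at N or at k * M is the same. *)
Lemma poly_ps_subst (A : powser) (k N M : nat) :
  (0 < k)%N -> (N <= k * M < N + k)%N ->
  \poly_(m < N) ps_subst k A m = (\poly_(m < M) A m) \Po 'X^k.
Proof.
move=> k0 /andP[N1 N2]; apply/polyP => i.
rewrite coef_poly coef_comp_poly_Xn // /ps_subst.
case: (boolP (k %| i)%N) => [/dvdnP[j ->]|_]; last by case: ifP.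
rewrite mulnK // coef_poly.
suff -> : (j * k < N)%N = (j < M)%N by [].
by apply/idP/idP => ?; nia.
Qed.

Lemma poly_ps_mulq (A : powser) (N : nat) :
  \poly_(m < N.+1) ps_mulq A m = 'X * \poly_(m < N) A m.
Proof. by apply/polyP => -[|i]; rewrite coefXM !coef_poly. Qed.

Lemma poly_ps_add (A B : powser) (N : nat) :
  \poly_(m < N) ps_add A B m = \poly_(m < N) A m + \poly_(m < N) B m.
Proof. by apply/polyP => i; rewrite coefD !coef_poly; case: ifP; rewrite ?addr0. Qed.

Lemma subrS1z (n : nat) : n.+1%:Z - 1 = n%:Z.
Proof. by lia. Qed.

(** Truncated subtraction is harmless here: the conventional value 1 at
    index -1 is also the truncation at index 0. *)
Lemma trunc2_pred (A : powser) (n : nat) :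
  A 0%N = 1 -> trunc2 A (n%:Z - 1) = \poly_(m < 2 ^ n.-1) A m.
Proof.
case: n => [|n] A0; last by rewrite subrS1z.
by rewrite /= expn0; apply/polyP => -[|i]; rewrite coef1 coef_poly.
Qed.

Lemma trunc2_coef0 (A : powser) (z : int) : A 0%N = 1 -> (trunc2 A z)`_0 = 1.
Proof. by case: z => n A0; rewrite ?coef1 // coef_poly expn_gt0. Qed.

Lemma trunc2_0 (A : powser) : A 0%N = 1 -> trunc2 A 0 = 1.
Proof. by move=> A0; apply/polyP => -[|i]; rewrite coef1 coef_poly. Qed.

Lemma trunc2_evenS (A B C : powser) (n : nat) :
  C 0%N = 1 -> A =1 ps_add (ps_subst 2 B) (ps_mulq (ps_subst 4 C)) ->
  trunc2 A n.+1%:Z =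
    (trunc2 B n%:Z \Po 'X^2) + 'X * (trunc2 C (n%:Z - 1) \Po 'X^4).
Proof.
move=> C0 eA; rewrite trunc2_pred //=.
under eq_poly => i _ do rewrite eA.
rewrite poly_ps_add (poly_ps_subst _ (M := 2 ^ n)) //; last first.
  by rewrite expnS; lia.
have [N eN] : exists N, (2 ^ n.+1 = N.+1)%N.
  by exists (2 ^ n.+1).-1; rewrite prednK ?expn_gt0.
rewrite eN poly_ps_mulq (poly_ps_subst _ (M := 2 ^ n.-1)) //.
by move: eN; case: n => [|n] /=; rewrite ?expnS; lia.
Qed.

Lemma trunc2_oddS (A B C : powser) (n : nat) :
  C 0%N = 1 -> A =1 ps_add (ps_mulq (ps_subst 2 B)) (ps_subst 4 C) ->
  trunc2 A n.+1%:Z =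
    'X * (trunc2 B n%:Z \Po 'X^2) + (trunc2 C (n%:Z - 1) \Po 'X^4).
Proof.
move=> C0 eA; rewrite trunc2_pred //=.
under eq_poly => i _ do rewrite eA.
rewrite poly_ps_add [X in _ + X](poly_ps_subst _ (M := 2 ^ n.-1)) //; last first.
  by case: n => [|n]; rewrite ?expnS /=; lia.
have [N eN] : exists N, (2 ^ n.+1 = N.+1)%N.
  by exists (2 ^ n.+1).-1; rewrite prednK ?expn_gt0.
rewrite eN poly_ps_mulq (poly_ps_subst _ (M := 2 ^ n)) //.
by move: eN; rewrite expnS; lia.
Qed.

(** * Substituting powers of the indeterminate *)

Lemma at_XnD (p q : {poly rat}) (k : nat) :
  at_Xn (p + q) k = at_Xn p k + at_Xn q k.
Proof. by rewrite /at_Xn comp_polyD rmorphD. Qed.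

Lemma at_XnXM (p : {poly rat}) (k : nat) :
  at_Xn ('X * p) k = ratX ^+ k * at_Xn p k.
Proof. by rewrite /at_Xn comp_polyM comp_polyX rmorphM rmorphXn. Qed.

Lemma at_Xn_comp (p : {poly rat}) (j k : nat) :
  at_Xn (p \Po 'X^j) k = at_Xn p (j * k).
Proof. by rewrite /at_Xn -comp_polyA comp_Xn_poly -exprM mulnC. Qed.

Lemma at_Xn1 (k : nat) : at_Xn 1 k = 1.
Proof. by rewrite /at_Xn comp_polyC rmorph1. Qed.

Lemma at_Xn_trunc2_neq0 (A : powser) (z : int) (k : nat) :
  A 0%N = 1 -> (0 < k)%N -> at_Xn (trunc2 A z) k != 0.
Proof.
move=> A0 k0; rewrite /at_Xn tofrac_eq0.
apply/eqP => /(congr1 (fun p : {poly rat} => p`_0)) /eqP.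
by rewrite coef_comp_poly_Xn // dvdn0 div0n trunc2_coef0 // coef0 oner_eq0.
Qed.

Lemma ratX_neq0 : ratX != 0.
Proof. by rewrite tofrac_eq0 polyX_eq0. Qed.

Lemma at_trunc2_evenS (A B C : powser) (n k : nat) :
  C 0%N = 1 -> A =1 ps_add (ps_subst 2 B) (ps_mulq (ps_subst 4 C)) ->
  at_Xn (trunc2 A n.+1%:Z) k =
    at_Xn (trunc2 B n%:Z) (2 * k)
      + ratX ^+ k * at_Xn (trunc2 C (n%:Z - 1)) (4 * k).
Proof.
by move=> C0 eA; rewrite (trunc2_evenS _ C0 eA) at_XnD at_XnXM !at_Xn_comp.
Qed.

Lemma at_trunc2_oddS (A B C : powser) (n k : nat) :
  C 0%N = 1 -> A =1 ps_add (ps_mulq (ps_subst 2 B)) (ps_subst 4 C) ->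
  at_Xn (trunc2 A n.+1%:Z) k =
    ratX ^+ k * at_Xn (trunc2 B n%:Z) (2 * k)
      + at_Xn (trunc2 C (n%:Z - 1)) (4 * k).
Proof.
by move=> C0 eA; rewrite (trunc2_oddS _ C0 eA) at_XnD at_XnXM !at_Xn_comp.
Qed.

(** * The continued fractions *)

Lemma mkseq_pow2S (K : fieldType) (n : nat) (x : K) :
  mkseq (fun i => x ^+ (2 ^ i)) n.+1 =
    x :: mkseq (fun i => (x ^+ 2) ^+ (2 ^ i)) n.
Proof.
rewrite /mkseq /= expr1 -[1%N]add1n iotaDl -map_comp; congr (_ :: _).
by apply: eq_map => i /=; rewrite add1n expnS exprM.
Qed.

Lemma lambdaS (K : fieldType) (n : nat) (x : K) :
  lambda n.+1 x = x + 1 / lambda n (x ^+ 2).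
Proof. by rewrite /lambda mkseq_pow2S. Qed.

Lemma lambda_plusS (K : fieldType) (n : nat) (x : K) :
  lambda_plus n.+1 x = x + 1 / lambda_plus n (x ^+ 2).
Proof.
rewrite /lambda_plus mkseq_pow2S expnS exprM rcons_cons.
by case: n => [|n] //; rewrite mkseq_pow2S.
Qed.

Lemma rho_trunc2 (H : powser) (n k : nat) : H_spec H -> (0 < k)%N ->
  rho n (ratX ^+ k) =
    at_Xn (trunc2 H n%:Z) k / at_Xn (trunc2 H (n%:Z - 1)) (2 * k).
Proof.
move=> [H0 eH]; elim: n k => [|n IH] k k0.
  by rewrite trunc2_0 // !at_Xn1 divr1.
rewrite [LHS]/= -exprM mulnC IH ?muln_gt0 // subrS1z (at_trunc2_evenS _ _ H0 eH).
rewrite mulnA invf_div mulrDl divff ?mulrA //.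
by rewrite at_Xn_trunc2_neq0 ?muln_gt0.
Qed.

Lemma lambda_plus_trunc2 (I : powser) (n k : nat) : I_spec I -> (0 < k)%N ->
  lambda_plus n (ratX ^+ k) =
    at_Xn (trunc2 I n.+1%:Z) k / at_Xn (trunc2 I n%:Z) (2 * k).
Proof.
move=> [I0 eI]; elim: n k => [|n IH] k k0.
  rewrite (at_trunc2_oddS _ _ I0 eI) trunc2_0 // !at_Xn1.
  by rewrite /lambda_plus /= expr1 divr1 mulr1.
rewrite lambda_plusS -exprM mulnC IH ?muln_gt0 //.
rewrite [in RHS](at_trunc2_oddS _ _ I0 eI) subrS1z mulnA.
by rewrite div1r invf_div mulrDl mulfK // at_Xn_trunc2_neq0 ?muln_gt0.
Qed.

Lemma lambda_step_even (K : fieldType) (y f g : K) : g != 0 ->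
  y + y ^+ 4 * f / g = y * (g + y ^+ 3 * f) / g.
Proof. by move=> g0; field. Qed.

Lemma lambda_step_odd (K : fieldType) (y f g : K) : y != 0 -> f != 0 ->
  y + g / (y ^+ 2 * f) = (y ^+ 3 * f + g) / (y ^+ 2 * f).
Proof. by move=> y0 f0; field; rewrite y0 f0. Qed.

(** The exponents 3 and 2 are what makes F and G fit: at q = x^3 the
    recursion for G produces x^3 = x * x^2, whose factor x^2 is the one in the
    denominator of the odd case, and the even case turns this factor, taken at
    x^2, into x^4 = x * x^3. *)
Lemma lambda_trunc2 (F G : powser) (n k : nat) : FG_spec F G -> (0 < k)%N ->
  lambda n (ratX ^+ k) =
    if odd n then
      at_Xn (trunc2 G n%:Z) (3 * k)
        / (ratX ^+ (2 * k) * at_Xn (trunc2 F (n%:Z - 1)) (6 * k))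
    else
      ratX ^+ k * at_Xn (trunc2 F n%:Z) (3 * k)
        / at_Xn (trunc2 G (n%:Z - 1)) (6 * k).
Proof.
move=> [F0 G0 eF eG]; elim: n k => [|n IH] k k0.
  by rewrite [odd 0]/= (trunc2_0 F0) !at_Xn1 divr1 mulr1 /lambda /= expr1.
have X0 : ratX ^+ k != 0 by rewrite expf_neq0 // ratX_neq0.
rewrite lambdaS -exprM mulnC IH ?muln_gt0 // oddS subrS1z div1r.
rewrite (at_trunc2_oddS _ _ G0 eG) (at_trunc2_evenS _ _ F0 eF) !mulnA.
have F60 : at_Xn (trunc2 F n%:Z) (6 * k) != 0.
  by rewrite at_Xn_trunc2_neq0 ?muln_gt0.
have G60 : at_Xn (trunc2 G n%:Z) (6 * k) != 0.
  by rewrite at_Xn_trunc2_neq0 ?muln_gt0.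
have eX j : ratX ^+ (j * k) = (ratX ^+ k) ^+ j by rewrite mulnC exprM.
rewrite -[(6 * 2)%N]/12%N -[(3 * 2)%N]/6%N -[(2 * 3)%N]/6%N -[(4 * 3)%N]/12%N.
rewrite -[(2 * 2)%N]/4%N !eX; case: (odd n); rewrite [~~ _]/= invf_div.
  exact: lambda_step_even G60.
exact: lambda_step_odd X0 F60.
Qed.

Theorem proposition1p2p8 (F G H I : powser)
    (hFG : FG_spec F G) (hH : H_spec H) (hI : I_spec I) (n : nat) :
  [/\ rho n ratX = at_Xn (trunc2 H n%:Z) 1 / at_Xn (trunc2 H (n%:Z - 1)) 2,
      lambda_plus n ratX =
        at_Xn (trunc2 I (n%:Z + 1)) 1 / at_Xn (trunc2 I n%:Z) 2,
      ~~ odd n -> lambda n ratX =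
        ratX * at_Xn (trunc2 F n%:Z) 3 / at_Xn (trunc2 G (n%:Z - 1)) 6
    & odd n -> lambda n ratX =
        at_Xn (trunc2 G n%:Z) 3 /
          (ratX ^+ 2 * at_Xn (trunc2 F (n%:Z - 1)) 6)].
Proof.
have eL := lambda_trunc2 n hFG (ltn0Sn 0); rewrite expr1 in eL.
split.
- by have := rho_trunc2 n hH (ltn0Sn 0); rewrite expr1.
- have := lambda_plus_trunc2 n hI (ltn0Sn 0).
  by rewrite expr1 (_ : n%:Z + 1 = n.+1%:Z) //; lia.
- by move=> /negbTE on; rewrite eL on.
- by move=> on; rewrite eL on.
Qed.
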